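(* Let $\mathcal U$ be a quasi-definite vector of linear functionals and let $\mathcal F$ be its generalized Markov matrix function. Let $\{\mathcal B_m\}_{m\in\mathbb N}$ be a sequence of vector polynomials, $\mathcal B_m(x)=V_m(h(x))\mathcal P_0(x)$ with $V_m$ an $N\times N$ matrix polynomial of degree $m$, and let $\{G_n\}_{n\in\mathbb N}$ be a sequence of $N\times N$ matrix polynomials with $\deg G_n=n$. Then the following statements are equivalent. (a) $\{G_n\}$ and $\{\mathcal B_m\}$ are bi-orthogonal with respect to $\mathcal U$, i.e. $$\big((G_n(h(x)))^T\mathcal U_x\big)(\mathcal B_m)=I_{N\times N}\,\delta_{n,m},\qquad n,m\in\mathbb N.$$ (b) $\{G_n\}$ and $\{V_m\}$ are bi-orthogonal with respect to $\mathcal F$, i.e. $$\frac1{2\pi i}\int_CV_m(z)\,\mathcal F(z)\,G_n(z)\,dz=I_{N\times N}\,\delta_{n,m},\qquad n,m\in\mathbb N,$$ where $C$ is a closed path in $\{z\in\mathbb C:|z|>|h(x)|,\ x\in\mathsf L\}$, winding once counterclockwise around the origin.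
   Context: $N\ge1$ is a fixed integer, $\mathbb N=\{0,1,2,\dots\}$, $h$ is a fixed real polynomial of degree $N$, $\mathbb P$ is the space of real polynomials, $\mathbb P^N$ the space of column vectors of $N$ polynomials. $\mathcal P_0(x)=[1\;x\;\cdots\;x^{N-1}]^T$ and $\mathcal P_j(x)=h(x)^j\mathcal P_0(x)$. A vector of linear functionals is $\mathcal U=[u^1\cdots u^N]^T$ with $u^j:\mathbb P\to\mathbb R$ linear; it acts on $\mathcal P=[p_1\cdots p_N]^T\in\mathbb P^N$ by the matrix $\mathcal U(\mathcal P)$ whose $(i,j)$ entry is $\langle u^j,p_i\rangle$ ($\mathcal U_x$ indicates that $\mathcal U$ acts on the variable $x$), and $(h^k\mathcal U)(\mathcal P):=\mathcal U(h^k\mathcal P)$. For a matrix polynomial $G(z)=\sum_k\beta_kz^k$ with real $N\times N$ coefficients, $\big((G(h(x)))^T\mathcal U\big)(\mathcal P)=\sum_k(h^k\mathcal U)(\mathcal P)\,\beta_k$. $\mathcal U$ is quasi-definite if all leading principal submatrices (of every size) of the block Hankel matrices $[\mathcal U(\mathcal P_{i+j})]_{i,j=0}^m$, $m\in\mathbb N$, are non-singular. The generalized Markov matrix function of $\mathcal U$ is $$\mathcal F(z)=\mathcal U_x\!\left(\frac{\mathcal P_0(x)}{z-h(x)}\right)=\left[\Big\langle u^j_x,\frac{x^{i-1}}{z-h(x)}\Big\rangle\right]_{i,j=1}^N,$$ for $z$ with $|z|>|h(x)|$ for every $x\in\mathsf L=\bigcup_{j=1}^N\operatorname{supp}u^j$.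 The set $h(\mathsf L)$ is assumed bounded, and the functionals are understood to act on $x^{i-1}/(z-h(x))$ for such $z$ through the convergent expansion $\mathcal F(z)=\sum_{n=0}^\infty \mathcal U(h^n\mathcal P_0)\,z^{-n-1}$. *)

(* Defs.v *)
From HB Require Import structures.
From mathcomp Require Import all_boot all_order all_algebra.
From mathcomp Require Import complex.
From mathcomp Require Import all_classical all_reals all_analysis.

Set Implicit Arguments.
Unset Strict Implicit.
Unset Printing Implicit Defensive.

Import Order.TTheory GRing.Theory Num.Theory numFieldNormedType.Exports.
Local Open Scope classical_set_scope.
Local Open Scope complex_scope.
Local Open Scope ring_scope.

Section Functionals.
Context {R : realType} {N : nat}.
Implicit Types (h : {poly R}) (P : 'cV[{poly R}]_N) (j k m : nat).

Definition functionals := 'I_N -> {scalar {poly R}}.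

Definition P0 : 'cV[{poly R}]_N := \col_i 'X^i.

Definition Pvec h j : 'cV[{poly R}]_N := h ^+ j *: P0.

(* The row index follows the polynomial, the column index the functional. *)
Definition act (u : functionals) P : 'M[R]_N := \matrix_(i, j) u j (P i 0).

Definition hankel h (u : functionals) m :=
  \mxblock_(i < m.+1, j < m.+1) act u (Pvec h (i + j)).

(* The sizes k range over all integers up to (m+1)N, not only over the
   multiples of N. *)
Definition quasi_definite h (u : functionals) : Prop :=
  forall m k (le_k : (k <= \sum_(i < m.+1) N)%N),
    mxsub (widen_ord le_k) (widen_ord le_k) (hankel h u m) \in unitmx.

End Functionals.
Arguments functionals : clear implicits.
Arguments P0 {R N}.

(* A matrix polynomial of degree d is an element of {poly 'M[R]_N} of size d.+1,
   whose leading coefficient is a nonzero, not necessarily invertible, matrix.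
   The coefficient ring is nontrivial only for N of the form N'.+1. *)

Section MatrixPolynomials.
Context {R : realType} {N' : nat}.
Local Notation N := N'.+1.

Definition mxpoly_comp (V : {poly 'M[R]_N}) (h : {poly R}) : 'M[{poly R}]_N :=
  (map_poly (map_mx polyC) V).[h%:M].

Definition mxpoly_eval (V : {poly 'M[R]_N}) (z : R[i]) : 'M[R[i]]_N :=
  (map_poly (map_mx (real_complex R)) V).[z%:M].

(* The action ((G(h))^T U)(P) of the vector of functionals (G(h))^T U. *)
Definition act_comp (G : {poly 'M[R]_N}) (h : {poly R}) (u : functionals R N)
    (P : 'cV[{poly R}]_N) : 'M[R]_N :=
  \sum_(k < size G) act u (h ^+ k *: P) *m G`_k.

End MatrixPolynomials.

Section Markov.
Context {R : realType} {N : nat}.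
Implicit Types (h : {poly R}) (u : functionals R N) (z : R[i]).

(* L is the union of the supports of the functionals.  A linear form on {poly R}
   has no intrinsic support, so the supports are data: closed sets such that the
   expansion markov_series converges on exterior h L. *)
Definition exterior h (L : set R) : set R[i] :=
  [set z | forall x, L x -> `|h.[x]|%:C < `|z|].

(* Partial sums of the (i, j) entry of \sum_n U(h^n P_0) z^(-n-1).  The regular
   algebra R[i]^o carries the norm topology of the complex numbers. *)
Definition markov_series h u z (i j : 'I_N) : nat -> R[i]^o :=
  series (fun n => (act u (Pvec h n) i j)%:C / z ^+ n.+1).

Definition markov_function h u z : 'M[R[i]]_N :=
  \matrix_(i, j) limn (markov_series h u z i j).

End Markov.

Section Contours.
Context {R : realType}.
Implicit Types (gamma : R -> R[i]) (a b : R).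
Local Notation re := (@complex.Re R).
Local Notation im := (@complex.Im R).

Definition path_derive gamma (t : R) : R[i] :=
  derive1 (re \o gamma) t +i* derive1 (im \o gamma) t.

Definition complex_Rintegral a b (f : R -> R[i]) : R[i] :=
  (\int[lebesgue_measure]_(t in `[a, b]) re (f t))
  +i* (\int[lebesgue_measure]_(t in `[a, b]) im (f t)).

Definition contour_integral gamma a b (f : R[i] -> R[i]) : R[i] :=
  complex_Rintegral a b (fun t => f (gamma t) * path_derive gamma t).

Definition mx_contour_integral m n gamma a b (F : R[i] -> 'M[R[i]]_(m, n)) :
    'M[R[i]]_(m, n) :=
  \matrix_(i, j) contour_integral gamma a b (fun z => F z i j).

Definition two_pi_i : R[i] := 0 +i* (2 * pi).

Definition winding_number gamma a b (w : R[i]) : R[i] :=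
  two_pi_i^-1 * contour_integral gamma a b (fun z => (z - w)^-1).

(* Continuously differentiable on `[c, d], with one-sided derivatives at the
   endpoints: the derivative on `]c, d[ extends continuously to `[c, d]. *)
Definition C1_on (f : R -> R) (c d : R) : Prop :=
  derivable_oo_LRcontinuous f c d /\
  exists2 df : R -> R, {within `[c, d], continuous df} &
                       {in `]c, d[, derive1 f =1 df}.

(* t lists the points of a subdivision a < t_1 < ... < t_k = b; the continuity
   of gamma at the t_i is contained in C1_on. *)
Definition piecewise_C1 gamma a b : Prop :=
  exists t : seq R,
    [/\ path <%R a t, last a t = b &
        forall k, (k < size t)%N ->
          C1_on (re \o gamma) (nth 0 (a :: t) k) (nth 0 t k) /\
          C1_on (im \o gamma) (nth 0 (a :: t) k) (nth 0 t k)].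

Definition closed_path_in (D : set R[i]) gamma a b : Prop :=
  [/\ a < b, piecewise_C1 gamma a b, gamma a = gamma b &
      forall t, a <= t <= b -> D (gamma t)].

End Contours.
Arguments two_pi_i : clear implicits.

(* Main.v *)
Require Import Defs.
From HB Require Import structures.
From mathcomp Require Import all_boot all_order all_algebra.
From mathcomp Require Import complex ring lra.
From mathcomp Require Import all_classical all_reals all_analysis measurable_realfun.

(** Both conditions say that two families of real matrices, indexed by
    [(n, m)], are Kronecker deltas, and the two families are equal: for
    all matrix polynomials [V] and [G],
[[
  1 / (2 pi i) * int_C V(z) F(z) G(z) dz  =  ((G(h))^T U)(V(h) P_0).
]]
    Indeed, write [V = sum_l V_l z^l] and [G = sum_k G_k z^k], and let
    [M_n = U(h^n P_0)].  The right-hand side is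
    [sum_(l, k) V_l M_(l+k) G_k] because [U] is linear
    ([act_comp_mxpoly]).  The left-hand side is
    [sum_(l, k) V_l J_(l+k) G_k] with
    [J_s = 1 / (2 pi i) * int_C z^s F(z) dz] ([mxpoly_eval_markov]).  So
    everything rests on [J_s = M_s]: the coefficients of the expansion
    [F(z) = sum_n M_n z^(-n-1)] are recovered by integrating along [C]
    ([has_contour_integral_laurent]).

    Termwise, [int_C z^(s-n-1) dz] vanishes for [n <> s], the integrand
    having a primitive on the punctured plane and [C] being closed; for
    [n = s] it is [2 pi i], which is the winding number hypothesis
    ([contour_integral_monomial]).  Exchanging sum and integral needs a
    bound on the partial sums that is uniform along [C].  As [h] is not
    constant and [h(L)] is bounded, the closed set [L] is compact, so [|h|]
    attains its maximum on [L]; the compact path [C] stays outside the disc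
    of that radius, hence outside a strictly larger one.  Thus there are
    [rho < r] such that the expansion converges at [rho] while [|z| >= r] on
    [C] ([exterior_separation]): convergence at [rho] makes
    [M_n / rho^(n+1)] bounded, and on [C] the expansion is dominated by a
    geometric series of ratio [rho / r].  Dominated convergence concludes.

    The path is only piecewise C1, and its derivative is not controlled at
    the finitely many break points.  Every fact about the path is therefore
    proved on one smooth piece and transported by concatenation
    ([piecewise_C1_ind]), and integrands are handled as bounded measurable
    functions, a class stable under all the operations involved. *)

Set Implicit Arguments.
Unset Strict Implicit.
Unset Printing Implicit Defensive.

Import Order.TTheory GRing.Theory Num.Theory numFieldNormedType.Exports.
Local Open Scope classical_set_scope.
Local Open Scope complex_scope.
Local Open Scope ring_scope.

(** * Sublevel sets of a real polynomial *)

Section Proper.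
Context {R : realType}.

(** Write [p = q 'X + c]: for [|x| >= 1], [|p.[x]|] is at least
    [|q.[x]| - |c|], and the only base case is a nonzero constant [q]. *)
Lemma poly_proper (p : {poly R}) (M : R) : (1 < size p)%N ->
  exists A : R, forall x, A < `|x| -> M < `|p.[x]|.
Proof.
elim/poly_ind: p M => [|q c IH] M; first by rewrite size_poly0.
case: (ltnP 1 (size q)) => [q1 _|q1 qc1].
  have [A HA] := IH (`|M| + `|c|) q1.
  exists (Num.max A 1) => x; rewrite gt_max => /andP[/HA Aq x1].
  rewrite hornerMXaddC.
  have : `|q.[x]| <= `|q.[x] * x| by rewrite normrM ler_peMr// ltW.
  have := ler_normB (q.[x] * x + c) c; rewrite addrK.
  have := ler_norm M; have := normr_ge0 c; lra.
have [k qk] : exists k, q = k%:P by exists (q`_0); exact: size1_polyC.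
have k0 : k != 0.
  apply: contraTneq qc1 => k0; rewrite qk k0 size_MXaddC polyC0 eqxx /=.
  by case: ifP; rewrite // size_poly0.
exists ((`|M| + `|c|) / `|k|) => x.
rewrite ltr_pdivrMr ?normr_gt0// hornerMXaddC qk hornerC => Hx.
have := ler_normB (k * x + c) c; rewrite addrK normrM mulrC.
have := ler_norm M; have := normr_ge0 c; lra.
Qed.

(** A nonconstant polynomial tends to infinity in absolute value, so [L] lies
    in a segment. *)
Lemma compact_poly_bounded (p : {poly R}) (L : set R) : (1 < size p)%N ->
  closed L -> bounded_set [set p.[x] | x in L] -> compact L.
Proof.
move=> p1 cL [M [_ HM]].
have [A HA] := poly_proper (M + 1) p1.
apply: (@subclosed_compact _ _ `[- A, A]) => //; first exact: segment_compact.
move=> x Lx /=; rewrite in_itv/= -ler_norml leNgt; apply/negP => /HA.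
apply/negP; rewrite -leNgt; apply: HM; first by rewrite ltrDl.
by exists x.
Qed.

Lemma compact_poly_max (p : {poly R}) (L : set R) : compact L ->
  L !=set0 -> exists2 c, L c & forall x, L x -> `|p.[x]| <= `|p.[c]|.
Proof.
move=> cL L0.
have [|c cLc Hc] := @compact_EVT_max _ R (fun x => `|p.[x]|) L L0 cL.
  apply: continuous_subspaceT => x.
  apply: continuous_comp; last exact: norm_continuous.
  exact: continuous_horner.
by exists c; [rewrite inE in cLc|move=> x Lx; apply: Hc; rewrite inE].
Qed.

End Proper.

(** * Continuously differentiable functions on a segment *)

Section RealC1.
Context {R : realType}.
Implicit Types (f g df dg : R -> R) (c d : R).

(** [C1_on] with the continuous extension [df] of the derivative made
    explicit, so that products and inverses come with a formula for it. *)
Definition C1_with f df c d : Prop :=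
  [/\ derivable_oo_LRcontinuous f c d,
      {within `[c, d], continuous df} &
      {in `]c, d[, derive1 f =1 df}].

Lemma C1_onP f c d : C1_on f c d -> exists df, C1_with f df c d.
Proof. by case=> Lf [df cdf fdf]; exists df; split. Qed.

Lemma C1_with_within f df c d :
  C1_with f df c d -> {within `[c, d], continuous f}.
Proof. by case=> /derivable_oo_LRcontinuous_within. Qed.

Lemma eq_C1 f f' df df' c d : f =1 f' -> df =1 df' ->
  C1_with f df c d -> C1_with f' df' c d.
Proof. by move=> /funext -> /funext ->. Qed.

Lemma C1_cst (k : R) c d : C1_with (cst k) (cst 0) c d.
Proof.
split=> [||x _]; last by rewrite derive1_cst.
- by split=> [x _||]; [exact: derivable_cst|exact: cvg_cst|exact: cvg_cst].
- by move=> x; exact: cst_continuous.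
Qed.

Lemma C1_add f df g dg c d : C1_with f df c d -> C1_with g dg c d ->
  C1_with (f + g) (df + dg) c d.
Proof.
move=> [[f1 f2 f3] cf ef] [[g1 g2 g3] cg eg]; split.
- by split=> [x xcd||]; [apply: derivableD; auto|exact: cvgD|exact: cvgD].
- exact: within_continuousD.
- move=> x xcd; rewrite derive1E deriveD; [|exact: f1|exact: g1].
  by rewrite -!derive1E ef// eg.
Qed.

Lemma C1_mul f df g dg c d : C1_with f df c d -> C1_with g dg c d ->
  C1_with (f * g) (df * g + f * dg) c d.
Proof.
move=> Hf Hg.
have wf := C1_with_within Hf; have wg := C1_with_within Hg.
move: Hf Hg => [[f1 f2 f3] cf ef] [[g1 g2 g3] cg eg]; split.
- by split=> [x xcd||]; [apply: derivableM; auto|exact: cvgM|exact: cvgM].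
- by apply: within_continuousD => x; apply: continuousM;
    [exact: cf|exact: wg|exact: wf|exact: cg].
- move=> x xcd; rewrite derive1E deriveM; [|exact: f1|exact: g1].
  rewrite -!derive1E ef// eg// /GRing.scale/= addrC.
  by rewrite [g x * _]mulrC.
Qed.

Lemma C1_inv f df c d : c < d -> (forall x, c <= x <= d -> f x != 0) ->
  C1_with f df c d ->
  C1_with (fun x => (f x)^-1) (fun x => - (f x) ^- 2 * df x) c d.
Proof.
move=> cd f0 Hf; have wf := C1_with_within Hf.
move: Hf => [[f1 f2 f3] cf ef].
have oc x : x \in `]c, d[ -> c <= x <= d.
  by rewrite in_itv/= => /andP[/ltW-> /ltW->].
have winv : {within `[c, d], continuous (fun x => (f x)^-1)}.
  by apply/subspace_continuousP => x /= xcd; apply: cvgV;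
    [apply: f0; move: xcd; rewrite in_itv|move/subspace_continuousP: wf; exact].
split.
- split=> [x xcd||]; first by apply: derivableV; [exact/f0/oc|exact: f1].
  + by apply: cvgV => //; apply: f0; rewrite lexx ltW.
  + by apply: cvgV => //; apply: f0; rewrite lexx ltW.
- rewrite [X in {within _, continuous X}](_ : _ =
    - ((fun x => (f x)^-1) * (fun x => (f x)^-1)) * df); last first.
    by apply/funext => x; rewrite !fctE -invfM -expr2.
  move=> x; apply: continuousM; last exact: cf.
  apply: continuousN; apply: continuousM; exact: winv.
- move=> x xcd; rewrite derive1E deriveV; [|exact/f0/oc|exact: f1].
  by rewrite -derive1E ef.
Qed.

Lemma C1_FTC f df c d : c < d -> C1_with f df c d ->
  \int[lebesgue_measure]_(t in `[c, d]) df t = f d - f c.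
Proof.
by move=> cd [Lf cf ef]; rewrite /Rintegral (continuous_FTC2 cd cf Lf ef).
Qed.

End RealC1.

(** * Complex-valued functions of a real variable *)

Section ComplexPaths.
Context {R : realType}.
Local Notation re := (@complex.Re R).
Local Notation im := (@complex.Im R).
Implicit Types (f g df dg : R -> R[i]) (c d : R) (z w k : R[i]).

Lemma Re_addc z w : re (z + w) = re z + re w. Proof. by case: z w => ? ? []. Qed.
Lemma Im_addc z w : im (z + w) = im z + im w. Proof. by case: z w => ? ? []. Qed.
Lemma Re_mulc z w : re (z * w) = re z * re w - im z * im w.
Proof. by case: z w => ? ? []. Qed.
Lemma Im_mulc z w : im (z * w) = re z * im w + im z * re w.
Proof. by case: z w => ? ? []. Qed.
Lemma Re_oppc z : re (- z) = - re z. Proof. by case: z. Qed.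
Lemma Im_oppc z : im (- z) = - im z. Proof. by case: z. Qed.
Lemma Re_invc z : re z^-1 = re z * (re z * re z + im z * im z)^-1.
Proof. by case: z => x y; rewrite -!expr2. Qed.
Lemma Im_invc z : im z^-1 = - im z * (re z * re z + im z * im z)^-1.
Proof. by case: z => x y; rewrite mulNr -!expr2. Qed.
Lemma complex_eqP z w : re z = re w -> im z = im w -> z = w.
Proof. by case: z w => ? ? [] ? ? /= -> ->. Qed.
Lemma Re_sqr_Im_sqr_neq0 z : z != 0 -> re z * re z + im z * im z != 0.
Proof.
apply: contra; rewrite -!expr2 paddr_eq0 ?sqr_ge0// !sqrf_eq0.
by case/andP => /eqP r0 /eqP i0; apply/eqP/complex_eqP.
Qed.

Lemma norm_ge_Re z (M : R) : `|z| <= M%:C -> `|re z| <= M.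
Proof. by rewrite -lecR; apply: le_trans; exact: normc_ge_Re. Qed.

Lemma norm_ge_Im z (M : R) : `|z| <= M%:C -> `|im z| <= M.
Proof.
rewrite -lecR; apply: le_trans.
case: z => x y; rewrite normc_def/= lecR -sqrtr_sqr ler_wsqrtr//.
by rewrite lerDr sqr_ge0.
Qed.

Lemma norm_le_ReIm z : `|z| <= (`|re z| + `|im z|)%:C.
Proof.
case: z => x y; rewrite [X in `|X|]complexE/=.
rewrite (le_trans (ler_normD _ _))// normrM rmorphD/=.
by rewrite !normc_def/= !expr0n/= !addr0 !add0r expr1n sqrtr1 mul1r !sqrtr_sqr.
Qed.

Definition cC1_with g dg c d : Prop :=
  C1_with (re \o g) (re \o dg) c d /\ C1_with (im \o g) (im \o dg) c d.

Lemma cC1_onP g c d : C1_on (re \o g) c d -> C1_on (im \o g) c d ->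
  exists dg, cC1_with g dg c d.
Proof.
by move=> /C1_onP[dr Hr] /C1_onP[di Hi]; exists (fun t => dr t +i* di t).
Qed.

Lemma eq_cC1 f g df dg c d : f =1 g -> df =1 dg ->
  cC1_with f df c d -> cC1_with g dg c d.
Proof. by move=> /funext -> /funext ->. Qed.

Lemma cC1_cst k c d : cC1_with (cst k) (cst 0) c d.
Proof. by split; exact: C1_cst. Qed.

Lemma cC1_mul f df g dg c d : cC1_with f df c d -> cC1_with g dg c d ->
  cC1_with (fun t => f t * g t) (fun t => df t * g t + f t * dg t) c d.
Proof.
move=> [rf jf] [rg jg]; split.
- apply: (eq_C1 _ _ (C1_add (C1_mul rf rg)
    (C1_mul (C1_mul (C1_cst (-1) c d) jf) jg))) => t; rewrite !fctE /=;
    case: (f t) (df t) (g t) (dg t) => [x y] [x1 y1] [x2 y2] [x3 y3] /=; ring.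
- apply: (eq_C1 _ _ (C1_add (C1_mul rf jg) (C1_mul jf rg))) => t; rewrite !fctE /=;
    case: (f t) (df t) (g t) (dg t) => [x y] [x1 y1] [x2 y2] [x3 y3] /=; ring.
Qed.

Lemma cC1_inv g dg c d : c < d -> (forall t, c <= t <= d -> g t != 0) ->
  cC1_with g dg c d ->
  cC1_with (fun t => (g t)^-1) (fun t => - (g t)^-1 ^+ 2 * dg t) c d.
Proof.
move=> cd g0 [rg jg].
have Hn := C1_add (C1_mul rg rg) (C1_mul jg jg).
have {}Hn := C1_inv cd (fun t tcd => Re_sqr_Im_sqr_neq0 (g0 t tcd)) Hn.
(* The two formulas for the derivative must agree everywhere, hence also at
   zeros of [g] outside the segment, where both vanish. *)
have E t : g t = 0 \/ re (g t) * re (g t) + im (g t) * im (g t) != 0.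
  by case: (eqVneq (g t) 0) => ?; [left|right; exact: Re_sqr_Im_sqr_neq0].
split.
- apply: (eq_C1 _ _ (C1_mul rg Hn)) => t; rewrite !fctE/= ?Re_invc//.
  case: (g t) (dg t) (E t) => [x y] [x1 y1]; rewrite expr2.
  rewrite !(Re_mulc, Im_mulc, Re_oppc, Im_oppc, Re_invc, Im_invc) /= => -[[-> ->]|n0].
    by rewrite !(mul0r, mulr0, oppr0, addr0, subr0, invr0).
  by field.
- apply: (eq_C1 _ _ (C1_mul (C1_mul (C1_cst (-1) c d) jg) Hn)) => t;
    rewrite !fctE/= ?Im_invc ?mulN1r//.
  case: (g t) (dg t) (E t) => [x y] [x1 y1]; rewrite expr2.
  rewrite !(Re_mulc, Im_mulc, Re_oppc, Im_oppc, Re_invc, Im_invc) /= => -[[-> ->]|n0].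
    by rewrite !(mul0r, mulr0, oppr0, addr0, subr0, invr0).
  by field.
Qed.

Lemma cC1_exp g dg c d n : cC1_with g dg c d ->
  cC1_with (fun t => g t ^+ n) (fun t => (g t ^+ n.-1 * dg t) *+ n) c d.
Proof.
move=> Hg; elim: n => [|n IH].
  by apply: (eq_cC1 _ _ (cC1_cst 1 c d)) => t; rewrite ?mulr0n.
apply: (eq_cC1 _ _ (cC1_mul Hg IH)) => t; rewrite /= ?exprS//.
case: n {IH} => [|n]; first by rewrite !mulr0n mulr0 addr0 mulrC.
by rewrite /= mulrnAr mulrA -exprS mulrC -mulrS.
Qed.

Lemma cC1_path_derive g dg c d t : cC1_with g dg c d -> t \in `]c, d[ ->
  path_derive g t = dg t.
Proof.
by move=> [[_ _ er] [_ _ ei]] tcd; rewrite /path_derive er// ei//=; case: (dg t).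
Qed.

Lemma cC1_FTC g dg c d : c < d -> cC1_with g dg c d ->
  complex_Rintegral c d dg = g d - g c.
Proof.
move=> cd [rg ig]; apply: complex_eqP => /=.
  by rewrite (C1_FTC cd rg) raddfB.
by rewrite (C1_FTC cd ig) raddfB.
Qed.

End ComplexPaths.

(** * Bounded measurable complex functions and their integrals *)

Section BoundedMeasurable.
Context {R : realType}.
Local Notation re := (@complex.Re R).
Local Notation im := (@complex.Im R).
Local Notation mu := (@lebesgue_measure R).
Implicit Types (D E : set R) (f g : R -> R[i]) (c d : R) (k : R[i]).

Definition bounded_measurable D g : Prop :=
  [/\ measurable_fun D (re \o g), measurable_fun D (im \o g) &
      exists M : R, forall t, D t -> `|g t| <= M%:C].

Lemma bounded_measurableU D E g : measurable D -> measurable E ->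
  bounded_measurable D g -> bounded_measurable E g ->
  bounded_measurable (D `|` E) g.
Proof.
move=> mD mE [mr mi [M HM]] [mr' mi' [M' HM']].
split; [exact/measurable_funU|exact/measurable_funU|exists (Num.max M M')].
move=> t [/HM|/HM'] /le_trans; apply; rewrite lecR le_max lexx ?orbT//.
Qed.

Lemma bounded_measurable_cst D k : bounded_measurable D (cst k).
Proof.
split; [exact: measurable_cst|exact: measurable_cst|].
by exists (re `|k|) => t _; rewrite RRe_real ?normr_real.
Qed.

Lemma bounded_measurableD D f g : bounded_measurable D f ->
  bounded_measurable D g -> bounded_measurable D (fun t => f t + g t).
Proof.
move=> [fr fi [M HM]] [gr gi [M' HM']]; split.
- rewrite [X in measurable_fun _ X](_ : _ = (re \o f) \+ (re \o g)).
    exact: measurable_funD.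
  by apply/funext => t /=; rewrite Re_addc.
- rewrite [X in measurable_fun _ X](_ : _ = (im \o f) \+ (im \o g)).
    exact: measurable_funD.
  by apply/funext => t /=; rewrite Im_addc.
- exists (M + M') => t Dt; rewrite rmorphD/= (le_trans (ler_normD _ _))// lerD//.
    exact: HM.
  exact: HM'.
Qed.

Lemma bounded_measurableM D f g : bounded_measurable D f ->
  bounded_measurable D g -> bounded_measurable D (fun t => f t * g t).
Proof.
move=> [fr fi [M HM]] [gr gi [M' HM']]; split.
- rewrite [X in measurable_fun _ X](_ : _ =
    ((re \o f) \* (re \o g)) \- ((im \o f) \* (im \o g))).
    by apply: measurable_funB; apply: measurable_funM.
  by apply/funext => t /=; rewrite Re_mulc.
- rewrite [X in measurable_fun _ X](_ : _ =
    ((re \o f) \* (im \o g)) \+ ((im \o f) \* (re \o g))).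
    by apply: measurable_funD; apply: measurable_funM.
  by apply/funext => t /=; rewrite Im_mulc.
- exists (M * M') => t Dt; rewrite rmorphM/= normrM ler_pM//; [exact: HM|exact: HM'].
Qed.

Lemma bounded_measurable_sum D (I : Type) (s : seq I) (F : I -> R -> R[i]) :
  (forall i, bounded_measurable D (F i)) ->
  bounded_measurable D (fun t => \sum_(i <- s) F i t).
Proof.
move=> HF; elim: s => [|i s IH].
  under eq_fun do rewrite big_nil; exact: bounded_measurable_cst.
under eq_fun do rewrite big_cons; exact: bounded_measurableD.
Qed.

Lemma bounded_measurableX D g n : bounded_measurable D g ->
  bounded_measurable D (fun t => g t ^+ n).
Proof.
move=> Hg; elim: n => [|n IH]; first exact: bounded_measurable_cst.
by under eq_fun do rewrite exprS; exact: bounded_measurableM.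
Qed.

Lemma cont_bounded_measurable g c d :
  {within `[c, d], continuous (re \o g)} ->
  {within `[c, d], continuous (im \o g)} ->
  bounded_measurable `[c, d] g.
Proof.
move=> cr ci; split; [exact: subspace_continuous_measurable_fun..|].
have H (f : R -> R) : {within `[c, d], continuous f} ->
    exists M, forall t, `[c, d]%classic t -> `|f t| <= M.
  move=> cf; have /compact_bounded[M [_ HM]] :=
    continuous_compact cf (@segment_compact _ c d).
  by exists (M + 1) => t tcd; apply: HM; [rewrite ltrDl|exists t].
have [M HM] := H _ cr; have [M' HM'] := H _ ci.
exists (M + M') => t tcd; apply: le_trans (norm_le_ReIm _) _.
by rewrite lecR lerD//; [exact: HM|exact: HM'].
Qed.

(** The derivative of a path is controlled only inside each smooth piece; its
    two values at the endpoints affect neither measurability nor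
    boundedness. *)
Lemma eq_oo_bounded_measurable f g c d : {in `]c, d[, f =1 g} ->
  bounded_measurable `[c, d] g -> bounded_measurable `[c, d] f.
Proof.
move=> fg [mr mi [M HM]].
have cc : `]c, d[ `<=` `[c, d] by apply: subset_itv; rewrite bnd_simp.
have H (p : R[i] -> R) : measurable_fun `[c, d] (p \o g) ->
    measurable_fun `[c, d] (p \o f).
  move=> mg; apply: (@measurable_fun_itv_cc _ _ _ false true).
  apply: (@eq_measurable_fun _ _ _ _ _ (p \o g)).
    by move=> t; rewrite inE/= => /fg ->.
  exact: measurable_funS mg.
split; [exact: H|exact: H|].
exists (Num.max M (Num.max (re `|f c|) (re `|f d|))) => t /=; rewrite in_itv/=.
case/andP; rewrite le_eqVlt => /predU1P[<- _|ct].
  by rewrite -[leLHS]RRe_real ?normr_real// lecR !le_max lexx orbT.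
rewrite le_eqVlt => /predU1P[->|td].
  by rewrite -[leLHS]RRe_real ?normr_real// lecR !le_max lexx !orbT.
rewrite fg ?in_itv/= ?ct// (le_trans (HM _ _))//=.
  by rewrite in_itv/= !ltW.
by rewrite lecR le_max lexx.
Qed.

Lemma bounded_measurable_integrable g c d : bounded_measurable `[c, d] g ->
  mu.-integrable `[c, d] (EFin \o (re \o g)) /\
  mu.-integrable `[c, d] (EFin \o (im \o g)).
Proof.
move=> [mr mi [M HM]].
have fin : (mu `[c, d] < +oo)%E.
  by apply: compact_finite_measure; exact: segment_compact.
split; apply: measurable_bounded_integrable => //; exists M;
  split; rewrite ?num_real// => x Mx t tcd /=; apply: (le_trans _ (ltW Mx));
  [apply: norm_ge_Re|apply: norm_ge_Im]; exact: HM.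
Qed.

Lemma complex_RintegralD f g c d : bounded_measurable `[c, d] f ->
  bounded_measurable `[c, d] g ->
  complex_Rintegral c d (fun t => f t + g t) =
  complex_Rintegral c d f + complex_Rintegral c d g.
Proof.
move=> /bounded_measurable_integrable[fr fi] /bounded_measurable_integrable[gr gi].
apply: complex_eqP; rewrite ?Re_addc ?Im_addc/= -RintegralD//;
  by apply: eq_Rintegral => t _; rewrite ?Re_addc ?Im_addc.
Qed.

Lemma complex_RintegralZ k f c d : bounded_measurable `[c, d] f ->
  complex_Rintegral c d (fun t => k * f t) = k * complex_Rintegral c d f.
Proof.
move=> /bounded_measurable_integrable[fr fi].
have iZ r h : mu.-integrable `[c, d] (EFin \o h) ->
    mu.-integrable `[c, d] (EFin \o (fun t => r * h t)).
  by move=> ih; apply: eq_integrable (integrableZl _ r ih).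
apply: complex_eqP; rewrite ?Re_mulc ?Im_mulc/= -!RintegralZl//.
- rewrite -RintegralB//; [|exact: iZ..].
  by apply: eq_Rintegral => t _; rewrite Re_mulc.
- rewrite -RintegralD//; [|exact: iZ..].
  by apply: eq_Rintegral => t _; rewrite Im_mulc.
Qed.

Lemma complex_Rintegral_sum (I : Type) (s : seq I) (F : I -> R -> R[i]) c d :
  (forall i, bounded_measurable `[c, d] (F i)) ->
  complex_Rintegral c d (fun t => \sum_(i <- s) F i t) =
  \sum_(i <- s) complex_Rintegral c d (F i).
Proof.
move=> HF; elim: s => [|i s IH].
  rewrite big_nil; under eq_fun do rewrite big_nil.
  by apply: complex_eqP; rewrite /= /Rintegral integral0.
rewrite big_cons -IH -complex_RintegralD//; last exact: bounded_measurable_sum.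
by congr complex_Rintegral; apply/funext => t; rewrite big_cons.
Qed.

Lemma eq_complex_Rintegral f g c d : (forall t, c <= t <= d -> f t = g t) ->
  complex_Rintegral c d f = complex_Rintegral c d g.
Proof.
by move=> fg; apply: complex_eqP => /=; apply: eq_Rintegral => t;
  rewrite inE/= in_itv/= => /fg ->.
Qed.

Lemma eq_oo_complex_Rintegral f g c d : c < d -> {in `]c, d[, f =1 g} ->
  bounded_measurable `[c, d] g ->
  complex_Rintegral c d f = complex_Rintegral c d g.
Proof.
move=> cd fg bg; have bf := eq_oo_bounded_measurable fg bg.
have [fr fi] := bounded_measurable_integrable bf.
have [gr gi] := bounded_measurable_integrable bg.
have E (h : R -> R) : mu.-integrable `[c, d] (EFin \o h) ->
    \int[mu]_(t in `[c, d]) h t = \int[mu]_(t in `]c, d[) h t.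
  move=> ih; rewrite -Rintegral_itv_obnd_cbnd; last first.
    by apply: integrableS ih => //; apply: subset_itvr; rewrite bnd_simp.
  rewrite -Rintegral_itv_bndo_bndc//.
  by apply: integrableS ih => //; apply: subset_itv; rewrite bnd_simp.
by apply: complex_eqP => /=; rewrite !E//; apply: eq_Rintegral => t;
  rewrite inE/= => /fg ->.
Qed.

Lemma itvcc_setU c d (e : R) : c <= d -> d <= e ->
  `[c, d]%classic `|` `[d, e]%classic = `[c, e]%classic.
Proof.
move=> cd de; apply/seteqP; split=> t /=; rewrite !in_itv/=.
  by case=> /andP[? ?]; apply/andP; split; lra.
by move=> /andP[ct te]; case: (leP t d) => td; [left|right]; apply/andP; split; lra.
Qed.

Lemma complex_Rintegral_cat f c d (e : R) : c < d -> d < e ->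
  bounded_measurable `[c, d] f -> bounded_measurable `[d, e] f ->
  complex_Rintegral c e f = complex_Rintegral c d f + complex_Rintegral d e f.
Proof.
move=> cd de f1 f2.
have bf : bounded_measurable `[c, e] f.
  by rewrite -(itvcc_setU (ltW cd) (ltW de)); exact: bounded_measurableU.
have [fr fi] := bounded_measurable_integrable bf.
have E (h : R -> R) : mu.-integrable `[c, e] (EFin \o h) ->
    \int[mu]_(t in `[c, e]) h t =
    \int[mu]_(t in `[c, d]) h t + \int[mu]_(t in `[d, e]) h t.
  move=> ih; rewrite -(@Rintegral_itv_obnd_cbnd _ d); last first.
    by apply: integrableS ih => //; apply: subset_itvr; rewrite bnd_simp ltW.
  rewrite -(Rintegral_itvB ih) ?bnd_simp ?(ltW cd)//; last exact: ltW.
  by rewrite addrC subrK.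
by apply: complex_eqP; rewrite ?Re_addc ?Im_addc /= E.
Qed.

End BoundedMeasurable.

(** * Dominated convergence for complex integrals *)

Section DominatedLimits.
Context {R : realType}.
Local Notation re := (@complex.Re R).
Local Notation im := (@complex.Im R).
Local Notation mu := (@lebesgue_measure R).

Lemma cvg_Re (u : nat -> R[i]^o) (l : R[i]^o) :
  u @ \oo --> l -> (fun n => re (u n)) @ \oo --> re l.
Proof.
move=> /cvgrPdist_le ul; apply/cvgrPdist_le => e e0.
have e0C : 0 < e%:C by rewrite ltcR.
apply: filterS (ul _ e0C) => n /norm_ge_Re.
by rewrite Re_addc Re_oppc.
Qed.

Lemma cvg_Im (u : nat -> R[i]^o) (l : R[i]^o) :
  u @ \oo --> l -> (fun n => im (u n)) @ \oo --> im l.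
Proof.
move=> /cvgrPdist_le ul; apply/cvgrPdist_le => e e0.
have e0C : 0 < e%:C by rewrite ltcR.
apply: filterS (ul _ e0C) => n /norm_ge_Im.
by rewrite Im_addc Im_oppc.
Qed.

Lemma Rintegral_dominated (F : nat -> R -> R) (f : R -> R) (c d M : R) :
  (forall n, measurable_fun `[c, d] (F n)) ->
  (forall n t, c <= t <= d -> `|F n t| <= M) ->
  (forall t, c <= t <= d -> F ^~ t @ \oo --> f t) ->
  [/\ measurable_fun `[c, d] f, forall t, c <= t <= d -> `|f t| <= M &
   \int[mu]_(t in `[c, d]) F n t @[n --> \oo] --> \int[mu]_(t in `[c, d]) f t].
Proof.
move=> mF HM Ff.
have mf : measurable_fun `[c, d] f.
  by apply: (measurable_fun_cvg mF) => t /=; rewrite in_itv/=; exact: Ff.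
have fM t : c <= t <= d -> `|f t| <= M.
  move=> tcd; have cvn : `|F n t| @[n --> \oo] --> `|f t| by apply: cvg_norm; exact: Ff.
  rewrite -(cvg_lim _ cvn)//; apply: limr_le; first exact: cvgP cvn.
  by apply: nearW => n; exact: HM.
have fin : (mu `[c, d] < +oo)%E.
  by apply: compact_finite_measure; exact: segment_compact.
have ig : mu.-integrable `[c, d] (cst M%:E).
  apply: (@measurable_bounded_integrable _ _ _ mu (cst M)) => //.
  by exists M; split; rewrite ?num_real// => x Mx t tcd /=;
    rewrite /= in_itv/= in tcd; rewrite ger0_norm ?(le_trans _ (fM _ tcd))// ltW.
split => //.
have h1 n : measurable_fun `[c, d] (fun t => (F n t)%:E).
  exact/measurable_EFinP.
have h2 : measurable_fun `[c, d] (fun t => (f t)%:E).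
  exact/measurable_EFinP.
have h3 : {ae mu, forall t, `[c, d]%classic t ->
    (F n t)%:E @[n --> \oo] --> (f t)%:E}.
  apply: aeW => t tcd; apply: cvg_EFin; first exact: nearW.
  by apply: Ff; rewrite /= in_itv/= in tcd.
have h4 : {ae mu, forall t n, `[c, d]%classic t ->
    (`|(F n t)%:E| <= cst M%:E t)%E}.
  apply: aeW => t n tcd; rewrite lee_fin; apply: HM.
  by rewrite /= in_itv/= in tcd.
have [intf _ cv] := @dominated_convergence _ _ _ mu `[c, d] (measurable_itv _)
  (fun n t => (F n t)%:E) (fun t => (f t)%:E) (cst M%:E) h1 h2 h3 ig h4.
rewrite /Rintegral; apply: fine_cvg; rewrite fineK//.
exact: integrable_fin_num.
Qed.

Lemma complex_Rintegral_dominated (F : nat -> R -> R[i]) (f : R -> R[i])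
    (c d M : R) :
  (forall n, bounded_measurable `[c, d] (F n)) ->
  (forall n t, c <= t <= d -> `|F n t| <= M%:C) ->
  (forall t, c <= t <= d ->
     (fun n => F n t : R[i]^o) @ \oo --> (f t : R[i]^o)) ->
  [/\ bounded_measurable `[c, d] f,
   (fun n => re (complex_Rintegral c d (F n))) @ \oo -->
     re (complex_Rintegral c d f) &
   (fun n => im (complex_Rintegral c d (F n))) @ \oo -->
     im (complex_Rintegral c d f)].
Proof.
move=> bF HM Ff.
have [|||mr fr cr] := @Rintegral_dominated (fun n => re \o F n) (re \o f) c d M.
- by move=> n; have [] := bF n.
- by move=> n t tcd; exact/norm_ge_Re/HM.
- by move=> t tcd; exact/cvg_Re/Ff.
have [|||mi fi ci] := @Rintegral_dominated (fun n => im \o F n) (im \o f) c d M.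
- by move=> n; have [] := bF n.
- by move=> n t tcd; exact/norm_ge_Im/HM.
- by move=> t tcd; exact/cvg_Im/Ff.
split => //; split => //; exists (M + M) => t /=; rewrite in_itv/= => tcd.
by rewrite (le_trans (norm_le_ReIm _))// lecR lerD//; [exact: fr|exact: fi].
Qed.

End DominatedLimits.

(** * Piecewise continuously differentiable paths *)

Section Paths.
Context {R : realType}.
Local Notation re := (@complex.Re R).
Local Notation im := (@complex.Im R).
Implicit Types (gamma : R -> R[i]) (a b c d : R).

(** Reduces a statement about a piecewise C1 path to its smooth pieces and to
    the concatenation of two consecutive parameter intervals. *)
Lemma piecewise_C1_ind gamma a b (Q : R -> R -> Prop) :
  a < b -> piecewise_C1 gamma a b ->
  (forall c d dg, a <= c -> c < d -> d <= b -> cC1_with gamma dg c d -> Q c d) ->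
  (forall c d e, c < d -> d < e -> Q c d -> Q d e -> Q c e) ->
  Q a b.
Proof.
move=> ab [t [tp tb tC1]] Qpiece Qcat.
have path_last (x : R) s : path <%R x s -> x <= last x s.
  elim: s x => //= y s IH x /andP[xy /IH]; exact/le_trans/ltW.
suff H s x : a <= x -> path <%R x s -> last x s = b -> s != [::] ->
    (forall k, (k < size s)%N ->
      C1_on (re \o gamma) (nth 0 (x :: s) k) (nth 0 s k) /\
      C1_on (im \o gamma) (nth 0 (x :: s) k) (nth 0 s k)) -> Q x b.
  apply: (H t) => //; apply: contraTneq ab => t0.
  by rewrite t0 /= in tb; rewrite tb ltxx.
elim: s x => // y s IH x ax /= /andP[xy ys] sb _ sC1.
have yb : y <= b by rewrite -sb path_last.
have Qxy : Q x y.
  have [/= C1r C1i] := sC1 0%N isT; have [dg Hdg] := cC1_onP C1r C1i.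
  exact: Qpiece Hdg.
have [s0|sn0] := eqVneq s [::]; first by rewrite s0 /= in sb; rewrite -sb.
have yltb : y < b.
  rewrite -sb; case: (s) sn0 ys => //= z s' _ /andP[yz /path_last].
  exact: lt_le_trans.
apply: (Qcat _ _ _ xy yltb Qxy); apply: IH => //; first exact: le_trans ax (ltW xy).
by move=> k ks; exact: (sC1 k.+1).
Qed.

Lemma cC1_bounded_measurable g dg c d : cC1_with g dg c d ->
  bounded_measurable `[c, d] g.
Proof.
case=> /C1_with_within gr /C1_with_within gi; exact: cont_bounded_measurable.
Qed.

Lemma cC1_derive_bounded_measurable g dg c d : cC1_with g dg c d ->
  bounded_measurable `[c, d] dg.
Proof. by case=> -[_ cr _] [_ ci _]; exact: cont_bounded_measurable. Qed.

Lemma path_bounded_measurable gamma a b : a < b -> piecewise_C1 gamma a b ->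
  bounded_measurable `[a, b] gamma.
Proof.
move=> ab pC1; pose Q c d := bounded_measurable `[c, d] gamma.
apply: (piecewise_C1_ind (Q := Q) ab pC1).
  by move=> c d dg _ _ _; exact: cC1_bounded_measurable.
move=> c d e cd de; rewrite /Q -(itvcc_setU (ltW cd) (ltW de)).
exact: bounded_measurableU.
Qed.

Lemma path_derive_bounded_measurable gamma a b :
  a < b -> piecewise_C1 gamma a b ->
  bounded_measurable `[a, b] (path_derive gamma).
Proof.
move=> ab pC1; pose Q c d := bounded_measurable `[c, d] (path_derive gamma).
apply: (piecewise_C1_ind (Q := Q) ab pC1).
  move=> c d dg _ _ _ Hg; apply: (eq_oo_bounded_measurable (g := dg)).
    by move=> t; exact: cC1_path_derive.
  exact: cC1_derive_bounded_measurable Hg.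
move=> c d e cd de; rewrite /Q -(itvcc_setU (ltW cd) (ltW de)).
exact: bounded_measurableU.
Qed.

Lemma path_inv_bounded_measurable gamma a b : a < b -> piecewise_C1 gamma a b ->
  (forall t, a <= t <= b -> gamma t != 0) ->
  bounded_measurable `[a, b] (fun t => (gamma t)^-1).
Proof.
move=> ab pC1 g0; pose Q c d := bounded_measurable `[c, d] (fun t => (gamma t)^-1).
apply: (piecewise_C1_ind (Q := Q) ab pC1).
  move=> c d dg ac cd db Hg; apply: cC1_bounded_measurable (cC1_inv cd _ Hg).
  by move=> t /andP[ct td]; apply: g0; rewrite (le_trans ac)// (le_trans td).
move=> c d e cd de; rewrite /Q -(itvcc_setU (ltW cd) (ltW de)).
exact: bounded_measurableU.
Qed.

(** The minimum of [|gamma|] on each smooth piece is attained. *)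
Lemma path_lower_bound gamma a b (r0 : R) : a < b -> piecewise_C1 gamma a b ->
  (forall t, a <= t <= b -> r0%:C < `|gamma t|) ->
  exists2 r, r0 < r & forall t, a <= t <= b -> r%:C <= `|gamma t|.
Proof.
move=> ab pC1 gr0.
pose Q c d := exists2 r, r0 < r & forall t, c <= t <= d -> r%:C <= `|gamma t|.
apply: (piecewise_C1_ind (Q := Q) ab pC1).
  move=> c d dg ac cd db [gr gi].
  have cn := C1_with_within (C1_add (C1_mul gr gr) (C1_mul gi gi)).
  have [x] := EVT_min (ltW cd) cn; rewrite in_itv/= => /andP[cx xd] xmin.
  exists (re `|gamma x|).
    rewrite -ltcR RRe_real ?normr_real//.
    by apply: gr0; rewrite (le_trans ac)// (le_trans xd).
  move=> t tcd; rewrite RRe_real ?normr_real// !normc_def lecR ler_wsqrtr//.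
  by rewrite !expr2; apply: xmin; rewrite in_itv.
move=> c d e cd de [r rr0 Hr] [r' rr0' Hr']; exists (Num.min r r').
  by rewrite lt_min rr0.
move=> t /andP[ct te]; case: (leP t d) => td.
  by apply: le_trans (Hr t _); rewrite ?ct// lecR ge_min lexx.
by apply: le_trans (Hr' t _); rewrite ?te ?(ltW td)// lecR ge_min lexx orbT.
Qed.

(** The fundamental theorem of calculus on each smooth piece; the contributions
    of the break points telescope.  That [F] is a primitive of [f] is stated
    along smooth paths, which avoids complex differentiability. *)
Lemma contour_integral_primitive gamma a b (f F : R[i] -> R[i]) :
  a < b -> piecewise_C1 gamma a b ->
  (forall c d dg, a <= c -> c < d -> d <= b -> cC1_with gamma dg c d ->
     cC1_with (F \o gamma) (fun t => f (gamma t) * dg t) c d) ->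
  contour_integral gamma a b f = F (gamma b) - F (gamma a).
Proof.
move=> ab pC1 HF; pose h t := f (gamma t) * path_derive gamma t.
pose Q c d := bounded_measurable `[c, d] h /\
  complex_Rintegral c d h = F (gamma d) - F (gamma c).
suff [] : Q a b by [].
apply: (piecewise_C1_ind (Q := Q) ab pC1).
  move=> c d dg ac cd db Hg; have HFg := HF _ _ _ ac cd db Hg.
  have bm := cC1_derive_bounded_measurable HFg.
  have hE : {in `]c, d[, h =1 (fun t => f (gamma t) * dg t)}.
    by move=> t tcd; rewrite /h (cC1_path_derive Hg tcd).
  split; first exact: eq_oo_bounded_measurable hE bm.
  by rewrite (eq_oo_complex_Rintegral cd hE bm) (cC1_FTC cd HFg).
move=> c d e cd de [b1 i1] [b2 i2]; split.
  by rewrite -(itvcc_setU (ltW cd) (ltW de)); exact: bounded_measurableU.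
by rewrite (complex_Rintegral_cat cd de b1 b2) i1 i2 addrC addrA subrK.
Qed.

Lemma contour_integral_pow gamma a b n : a < b -> piecewise_C1 gamma a b ->
  gamma a = gamma b -> contour_integral gamma a b (fun z => z ^+ n) = 0.
Proof.
move=> ab pC1 gab.
rewrite (@contour_integral_primitive _ _ _ _
  (fun z => n.+1%:R^-1 * z ^+ n.+1) ab pC1).
  by rewrite gab subrr.
move=> c d dg _ _ _ Hg.
have Hn := cC1_exp n.+1 Hg.
apply: (eq_cC1 _ _ (cC1_mul (cC1_cst n.+1%:R^-1 c d) Hn)) => t //=.
by rewrite mul0r add0r -[(_ * _) *+ _]mulr_natl mulrA mulVf ?mul1r// pnatr_eq0.
Qed.

Lemma contour_integral_inv_pow gamma a b n : a < b -> piecewise_C1 gamma a b ->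
  gamma a = gamma b -> (forall t, a <= t <= b -> gamma t != 0) ->
  contour_integral gamma a b (fun z => z^-1 ^+ n.+2) = 0.
Proof.
move=> ab pC1 gab g0.
rewrite (@contour_integral_primitive _ _ _ _
  (fun z => - n.+1%:R^-1 * z^-1 ^+ n.+1) ab pC1).
  by rewrite gab subrr.
move=> c d dg ac cd db Hg.
have g0' t : c <= t <= d -> gamma t != 0.
  by move=> /andP[ct td]; apply: g0; rewrite (le_trans ac)// (le_trans td).
have Hi := cC1_exp n.+1 (cC1_inv cd g0' Hg).
apply: (eq_cC1 _ _ (cC1_mul (cC1_cst (- n.+1%:R^-1) c d) Hi)) => t //=.
rewrite mul0r add0r -[(_ * _) *+ _]mulr_natl mulrA mulNr mulVf ?pnatr_eq0// mulN1r.
by rewrite mulNr mulrN opprK mulrA -exprD addn2.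
Qed.

End Paths.

(** * Contour integrals and Laurent coefficients *)

Lemma two_pi_i_neq0 (R : realType) : two_pi_i R != 0.
Proof.
by rewrite /two_pi_i eq_complex/= eqxx/= mulf_neq0 ?pnatr_eq0// gt_eqF ?pi_gt0.
Qed.

Lemma geometric_sum_le (R : realFieldType) (q : R) n : 0 <= q -> q < 1 ->
  \sum_(k < n) q ^+ k.+1 <= (1 - q)^-1.
Proof.
move=> q0 q1; have q1' : 0 < 1 - q by rewrite subr_gt0.
rewrite -(ler_pM2l q1') mulfV ?gt_eqF//.
under eq_bigr do rewrite exprS; rewrite -mulr_sumr mulrCA.
have -> : (1 - q) * \sum_(i < n) q ^+ i = 1 - q ^+ n.
  by rewrite -[1 - q ^+ n]opprB subrX1 -mulNr opprB.
apply: mulr_ile1 => //; first by rewrite subr_ge0 exprn_ile1// ltW.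
  exact: ltW.
by rewrite gerBl exprn_ge0.
Qed.

Section ContourIntegrals.
Context {R : realType}.
Context (gamma : R -> R[i]) (a b : R).
Context (ab : a < b) (pC1 : piecewise_C1 gamma a b).

(** Boundedness is carried along with the value because the integral is linear
    only on integrable functions. *)
Definition has_contour_integral (f : R[i] -> R[i]) (v : R[i]) : Prop :=
  bounded_measurable `[a, b] (f \o gamma) /\ contour_integral gamma a b f = v.

Lemma has_contour_integralZ f v k : has_contour_integral f v ->
  has_contour_integral (fun z => k * f z) (k * v).
Proof.
move=> [bf <-]; split.
  exact: (bounded_measurableM (bounded_measurable_cst _ k) bf).
rewrite -complex_RintegralZ.
  by congr complex_Rintegral; apply/funext => t; rewrite mulrA.
exact: bounded_measurableM bf (path_derive_bounded_measurable ab pC1).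
Qed.

Lemma has_contour_integral_sum (I : Type) (s : seq I)
    (F : I -> R[i] -> R[i]) (v : I -> R[i]) :
  (forall i, has_contour_integral (F i) (v i)) ->
  has_contour_integral (fun z => \sum_(i <- s) F i z) (\sum_(i <- s) v i).
Proof.
move=> HF; split.
  apply: (bounded_measurable_sum s (F := fun i t => F i (gamma t))) => i.
  by case: (HF i).
rewrite /contour_integral; under eq_fun do rewrite mulr_suml.
rewrite complex_Rintegral_sum; last first.
  move=> i; apply: bounded_measurableM; first by case: (HF i).
  exact: path_derive_bounded_measurable.
by apply: eq_bigr => i _; case: (HF i).
Qed.

Definition has_mx_contour_integral m n (F : R[i] -> 'M[R[i]]_(m, n))
    (W : 'M[R[i]]_(m, n)) : Prop :=
  forall i j, has_contour_integral (fun z => F z i j) (W i j).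

Lemma has_mx_contour_integral_sum m n (I : Type) (s : seq I)
    (F : I -> R[i] -> 'M[R[i]]_(m, n)) (W : I -> 'M[R[i]]_(m, n)) :
  (forall i, has_mx_contour_integral (F i) (W i)) ->
  has_mx_contour_integral (fun z => \sum_(i <- s) F i z) (\sum_(i <- s) W i).
Proof.
move=> HF i j; rewrite summxE.
under [X in has_contour_integral X]eq_fun do rewrite summxE.
by apply: has_contour_integral_sum => k; exact: HF.
Qed.

Lemma has_mx_contour_integralM m n p q (A : 'M[R[i]]_(m, n))
    (B : 'M[R[i]]_(p, q))
    (F : R[i] -> 'M[R[i]]_(n, p)) (W : 'M[R[i]]_(n, p)) :
  has_mx_contour_integral F W ->
  has_mx_contour_integral (fun z => A *m F z *m B) (A *m W *m B).
Proof.
move=> HF i j.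
have E (X : 'M[R[i]]_(n, p)) :
    (A *m X *m B) i j = \sum_k \sum_l (A i l * B k j) * X l k.
  rewrite mxE; apply: eq_bigr => k _; rewrite mxE mulr_suml.
  by apply: eq_bigr => l _; rewrite mulrAC.
rewrite E; under [X in has_contour_integral X]eq_fun do rewrite E.
do 2 apply: has_contour_integral_sum => ?; exact/has_contour_integralZ/HF.
Qed.

Lemma has_mx_contour_integralE m n (F : R[i] -> 'M[R[i]]_(m, n)) W :
  has_mx_contour_integral F W -> mx_contour_integral gamma a b F = W.
Proof. by move=> HF; apply/matrixP => i j; rewrite mxE; case: (HF i j). Qed.

Context (g_closed : gamma a = gamma b)
  (g_neq0 : forall t, a <= t <= b -> gamma t != 0)
  (g_winding : winding_number gamma a b 0 = 1).

(** Every power of [z] but [z^-1] has a primitive; the integral of [z^-1] is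
    [2 pi i] times the winding number around the origin. *)
Lemma contour_integral_monomial s n :
  contour_integral gamma a b (fun z => z ^+ s / z ^+ n.+1) =
  if n == s then two_pi_i R else 0.
Proof.
have E (f g : R[i] -> R[i]) : (forall z, z != 0 -> f z = g z) ->
    contour_integral gamma a b f = contour_integral gamma a b g.
  move=> fg; apply: eq_complex_Rintegral => t tab; rewrite fg//; exact: g_neq0.
case: (ltngtP n s) => [ns|sn|->].
- rewrite (E _ (fun z => z ^+ (s - n.+1))) ?contour_integral_pow//.
  by move=> z z0; rewrite -expfB_cond//= ?(negbTE z0)// add0n.
- rewrite (E _ (fun z => z^-1 ^+ (n - s.+1).+2)) ?contour_integral_inv_pow//.
  move=> z z0; have -> : n.+1 = ((n - s.+1).+2 + s)%N.
    by rewrite !addSn -addnS subnK.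
  by rewrite exprD invfM mulrCA mulfV ?expf_neq0// mulr1 exprVn.
- rewrite (E _ (fun z => (z - 0)^-1)); last first.
    by move=> z z0; rewrite subr0 exprSr invfM mulrA mulfV ?expf_neq0// mul1r.
  apply: (mulfI (invr_neq0 (two_pi_i_neq0 R))).
  by rewrite mulVf ?two_pi_i_neq0.
Qed.

(** With [f(z) = sum_n alpha_n z^(-n-1)] on the path, the partial sums are
    bounded there by [K / (1 - rho / r)], and as soon as they contain the term
    of index [s] the integral of their product with [z^s] is the constant
    [2 pi i alpha_s]. *)
Lemma has_contour_integral_laurent (alpha : nat -> R[i]) (f : R[i] -> R[i])
    (K rho r : R) (s : nat) :
  0 < rho -> rho < r -> (forall t, a <= t <= b -> r%:C <= `|gamma t|) ->
  (forall n, `|alpha n| <= (K * rho ^+ n.+1)%:C) ->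
  (forall t, a <= t <= b ->
     (series (fun n => alpha n / gamma t ^+ n.+1) : nat -> R[i]^o) @ \oo -->
     (f (gamma t) : R[i]^o)) ->
  has_contour_integral (fun z => z ^+ s * f z) (two_pi_i R * alpha s).
Proof.
move=> rho0 rhor gr alphaK fE.
have r0 : 0 < r by exact: lt_trans rhor.
have bg := path_bounded_measurable ab pC1.
have bg' := path_derive_bounded_measurable ab pC1.
have bgV := path_inv_bounded_measurable ab pC1 g_neq0.
pose S n t : R[i] := \sum_(k < n) alpha k * (gamma t)^-1 ^+ k.+1.
have SE n t : S n t = series (fun n => alpha n / gamma t ^+ n.+1) n.
  by rewrite /series/= big_mkord; apply: eq_bigr => k _; rewrite exprVn.
have bS n : bounded_measurable `[a, b] (S n).
  apply: (bounded_measurable_sum (index_enum 'I_n)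
    (F := fun k t => alpha k * (gamma t)^-1 ^+ k.+1)) => k.
  apply: bounded_measurableM; first exact: bounded_measurable_cst.
  exact: bounded_measurableX.
have K0 : 0 <= K.
  have := le_trans (normr_ge0 _) (alphaK 0%N).
  by rewrite ler0c expr1 pmulr_lge0.
pose MS := K * (1 - rho / r)^-1.
have SM n t : a <= t <= b -> `|S n t| <= MS%:C.
  move=> tab; apply: (@le_trans _ _ (\sum_(k < n) K * (rho / r) ^+ k.+1)%:C).
    rewrite rmorph_sum/=; apply: le_trans (ler_norm_sum _ _ _) _.
    apply: ler_sum => k _; rewrite normrM normrX normfV exprMn mulrA rmorphM/=.
    apply: ler_pM => //; rewrite rmorphXn/= fmorphV/=.
    have rC0 : 0 < r%:C by rewrite ltcR.
    have g0 : 0 < `|gamma t| by apply: lt_le_trans rC0 _; exact: gr.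
    apply: lerXn2r; rewrite ?nnegrE ?invr_ge0 ?(ltW rC0)//.
    by rewrite lef_pV2 ?posrE//; exact: gr.
  rewrite lecR -mulr_sumr ler_wpM2l// geometric_sum_le//.
    by rewrite divr_ge0// ltW.
  by rewrite ltr_pdivrMr// mul1r.
have SF t : a <= t <= b ->
    (fun n => S n t : R[i]^o) @ \oo --> (f (gamma t) : R[i]^o).
  by move=> tab; under eq_fun do rewrite SE; exact: fE.
(* A first use of dominated convergence, for the measurability of [f] along the
   path. *)
have [bf _ _] := complex_Rintegral_dominated bS SM SF.
have bgs := bounded_measurableX s bg.
split; first exact: (bounded_measurableM bgs bf).
pose w t := gamma t ^+ s * path_derive gamma t.
have bw : bounded_measurable `[a, b] w by exact: bounded_measurableM.
have [_ _ [Mw HMw]] := bw.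
pose F n t := S n t * w t.
have bF n : bounded_measurable `[a, b] (F n) by exact: bounded_measurableM.
have FM n t : a <= t <= b -> `|F n t| <= (MS * Mw)%:C.
  move=> tab; rewrite normrM rmorphM/= ler_pM//; first exact: SM.
  by apply: HMw; rewrite /= in_itv.
have FF t : a <= t <= b ->
    (fun n => F n t : R[i]^o) @ \oo --> (f (gamma t) * w t : R[i]^o).
  by move=> tab; apply: (@cvgM R[i]); [exact: SF|exact: cvg_cst].
have [_ cr ci] := complex_Rintegral_dominated bF FM FF.
have -> : contour_integral gamma a b (fun z => z ^+ s * f z) =
    complex_Rintegral a b (fun t => f (gamma t) * w t).
  by congr complex_Rintegral; apply/funext => t; rewrite /w mulrA [f _ * _]mulrC.
have FE n : (s < n)%N -> complex_Rintegral a b (F n) = two_pi_i R * alpha s.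
  move=> sn; pose m k t := gamma t ^+ s / gamma t ^+ k.+1 * path_derive gamma t.
  have bm k : bounded_measurable `[a, b] (m k).
    have -> : m k =
        fun t => gamma t ^+ s * (gamma t)^-1 ^+ k.+1 * path_derive gamma t.
      by apply/funext => t; rewrite exprVn.
    apply: bounded_measurableM => //; apply: bounded_measurableM => //.
    exact: bounded_measurableX.
  have -> : F n = fun t => \sum_(k < n) alpha k * m k t.
    apply/funext => t; rewrite /F /S mulr_suml; apply: eq_bigr => k _.
    by rewrite /w /m exprVn -!mulrA; congr (_ * _); rewrite mulrCA.
  rewrite (complex_Rintegral_sum (index_enum 'I_n)
    (F := fun k t => alpha k * m k t)); last first.
    move=> k; apply: bounded_measurableM => //.
    exact: bounded_measurable_cst.
  rewrite (bigD1 (Ordinal sn))//= big1 ?addr0.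
    rewrite complex_RintegralZ// mulrC.
    by have := contour_integral_monomial s s; rewrite eqxx => <-.
  move=> k ks; rewrite complex_RintegralZ//.
  have := contour_integral_monomial s k; rewrite ifN; last first.
    by apply: contra ks => /eqP ks; apply/eqP/val_inj.
  by rewrite /contour_integral/= => ->; rewrite mulr0.
have lim_unique (p : R[i] -> R) :
    (fun n => p (complex_Rintegral a b (F n))) @ \oo -->
      p (complex_Rintegral a b (fun t => f (gamma t) * w t)) ->
    p (complex_Rintegral a b (fun t => f (gamma t) * w t)) =
      p (two_pi_i R * alpha s).
  move=> /cvg_lim <- //; apply: lim_near_cst => //.
  by exists s.+1 => // n /= sn; rewrite FE.
by apply: complex_eqP; [exact: lim_unique cr|exact: lim_unique ci].
Qed.

End ContourIntegrals.

(** * Domination of the Markov expansion along the path *)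

Section MarkovExpansion.
Context {R : realType}.

(** The general term of a convergent series is bounded. *)
Lemma laurent_coef_bound (c : nat -> R) (rho : R) : 0 < rho ->
  cvgn (series (fun n => (c n)%:C / rho%:C ^+ n.+1) : nat -> R[i]^o) ->
  exists K : R, forall n, `|(c n)%:C| <= (K * rho ^+ n.+1)%:C.
Proof.
move=> rho0 /cvg_series_cvg_0 /cvg_Re c0.
have /cvg_seq_bounded[M [_ HM]] := cvgP _ c0.
exists (M + 1) => n; have /= := HM (M + 1) _ n I; rewrite ltrDl ltr01 => /(_ isT).
rewrite -rmorphXn -fmorphV -rmorphM/= normrM normfV normrX (gtr0_norm rho0).
rewrite ler_pdivrMr ?exprn_gt0// normc_def/= expr0n addr0 sqrtr_sqr lecR.
exact.
Qed.

(** Convergence at the points of the path alone would give no uniform bound: a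
    point [rho] of the exterior domain, of modulus smaller than the whole path,
    is needed.  Any radius between the maximum of [|h|] on [L], or 0 if [L] is empty, and the
    minimum of [|gamma|] is suitable. *)
Lemma exterior_separation (h : {poly R}) (L : set R) (gamma : R -> R[i])
    (a b : R) :
  (1 < size h)%N -> closed L -> bounded_set [set h.[x] | x in L] ->
  closed_path_in (exterior h L) gamma a b ->
  (forall t, a <= t <= b -> gamma t != 0) ->
  exists rho r : R, [/\ 0 < rho, rho < r, exterior h L rho%:C &
    forall t, a <= t <= b -> r%:C <= `|gamma t|].
Proof.
move=> h1 cL bL [ab pC1 gab gext] g0.
have [r0 r00 [r0L r0g]] : exists2 r0 : R, 0 <= r0 &
    (forall x, L x -> `|h.[x]| <= r0) /\
    (forall t, a <= t <= b -> r0%:C < `|gamma t|).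
  have [->|L0] := eqVneq L set0.
    by exists 0 => //; split=> // t /g0; rewrite normr_gt0.
  move/set0P: L0 => L0.
  have [c Lc Hc] := compact_poly_max h (compact_poly_bounded h1 cL bL) L0.
  by exists `|h.[c]| => //; split=> // t /gext; exact.
have [r r0r Hr] := path_lower_bound ab pC1 r0g.
have Hmid : r0 < (r0 + r) / 2 < r by apply/andP; split; lra.
case/andP: Hmid => m1 m2; exists ((r0 + r) / 2), r; split => //.
  exact: le_lt_trans m1.
move=> x /r0L hx; rewrite normc_def/= expr0n addr0 sqrtr_sqr ltcR.
by rewrite (le_lt_trans hx)// (lt_le_trans m1)// ler_norm.
Qed.

End MarkovExpansion.

(** * Expansion of both sides over the coefficients of the polynomials *)

Section Algebra.
Context {R : realType} {N' : nat}.
Local Notation N := N'.+1.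
Local Notation toC := (map_mx (real_complex R)).
Implicit Types (V G : {poly 'M[R]_N}) (h : {poly R}) (u : functionals R N).

Lemma mxpoly_evalE V z :
  mxpoly_eval V z = \sum_(l < size V) z ^+ l *: toC V`_l.
Proof.
rewrite /mxpoly_eval (horner_coef_wide _ (size_poly _ _)).
apply: eq_bigr => l _; rewrite coef_map -rmorphXn/=.
by rewrite -mulmxE mul_mx_scalar.
Qed.

Lemma mxpoly_compE V h :
  mxpoly_comp V h = \sum_(l < size V) h ^+ l *: map_mx polyC V`_l.
Proof.
rewrite /mxpoly_comp (horner_coef_wide _ (size_poly _ _)).
apply: eq_bigr => l _; rewrite coef_map -rmorphXn/=.
by rewrite -mulmxE mul_mx_scalar.
Qed.

Lemma act_sum u (I : Type) (s : seq I) (P : I -> 'cV[{poly R}]_N) :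
  act u (\sum_(i <- s) P i) = \sum_(i <- s) act u (P i).
Proof.
apply/matrixP => i j; rewrite !(mxE, summxE) linear_sum.
by apply: eq_bigr => k _; rewrite mxE.
Qed.

Lemma act_mulmx u (A : 'M[R]_N) (P : 'cV[{poly R}]_N) :
  act u (map_mx polyC A *m P) = A *m act u P.
Proof.
apply/matrixP => i j; rewrite !mxE linear_sum.
by apply: eq_bigr => k _; rewrite !mxE mul_polyC linearZ.
Qed.

Lemma act_comp_mxpoly V G h u :
  act_comp G h u (mxpoly_comp V h *m P0) =
  \sum_(l < size V) \sum_(k < size G) V`_l *m act u (Pvec h (l + k)) *m G`_k.
Proof.
rewrite exchange_big; apply: eq_bigr => k _; rewrite -mulmx_suml; congr (_ *m _).
rewrite mxpoly_compE mulmx_suml scaler_sumr act_sum; apply: eq_bigr => l _.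
by rewrite -scalemxAl scalerA scalemxAr act_mulmx -exprD addnC.
Qed.

Lemma mxpoly_eval_markov V G h u z :
  mxpoly_eval V z *m markov_function h u z *m mxpoly_eval G z =
  \sum_(l < size V) \sum_(k < size G)
    toC V`_l *m (z ^+ (l + k) *: markov_function h u z) *m toC G`_k.
Proof.
rewrite !mxpoly_evalE mulmx_suml mulmx_suml; apply: eq_bigr => l _.
rewrite mulmx_sumr; apply: eq_bigr => k _.
by rewrite -!scalemxAl -!scalemxAr -!scalemxAl scalerA exprD mulrC.
Qed.

End Algebra.

(** * The equivalence *)

Theorem theorem9 (R : realType) (N' : nat)
  (h : {poly R}) (h_deg : size h = N'.+2)
  (u : functionals R N'.+1) (u_qd : quasi_definite h u)
  (supp : 'I_N'.+1 -> set R) (supp_closed : forall j, closed (supp j))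
  (L : set R) (L_def : L = \bigcup_j supp j)
  (hL_bounded : bounded_set [set h.[x] | x in L])
  (markov_cvg : forall z, exterior h L z ->
     forall i j, cvgn (markov_series h u z i j))
  (V : nat -> {poly 'M[R]_N'.+1}) (V_deg : forall m, size (V m) = m.+1)
  (B : nat -> 'cV[{poly R}]_N'.+1)
  (B_def : forall m, B m = mxpoly_comp (V m) h *m P0)
  (G : nat -> {poly 'M[R]_N'.+1}) (G_deg : forall n, size (G n) = n.+1)
  (gamma : R -> R[i]) (a b : R)
  (C_path : closed_path_in (exterior h L) gamma a b)
  (C_avoids_0 : forall t, a <= t <= b -> gamma t != 0)
  (C_winding : winding_number gamma a b 0 = 1) :
  (forall n m : nat,
     act_comp (G n) h u (B m) = (if n == m then 1%:M else 0)) <->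
  (forall n m : nat,
     (two_pi_i R)^-1 *: mx_contour_integral gamma a b
       (fun z => mxpoly_eval (V m) z *m markov_function h u z *m mxpoly_eval (G n) z)
     = (if n == m then 1%:M else 0)).
Proof.
have h1 : (1 < size h)%N by rewrite h_deg.
have cL : closed L.
  rewrite L_def; apply: closed_bigcup => [|j _]; last exact: supp_closed.
  exact: finite_finset.
have [rho [r [rho0 rhor rhoL gr]]] :=
  exterior_separation h1 cL hL_bounded C_path C_avoids_0.
have [ab pC1 gab gext] := C_path.
have base s : has_mx_contour_integral gamma a b
    (fun z => z ^+ s *: markov_function h u z)
    (two_pi_i R *: map_mx (real_complex R) (act u (Pvec h s))).
  move=> i j.
  have [K HK] := laurent_coef_bound rho0 (markov_cvg _ rhoL i j).
  have -> : (fun z => (z ^+ s *: markov_function h u z) i j) =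
      (fun z => z ^+ s * markov_function h u z i j).
    by apply/funext => z; rewrite mxE.
  rewrite [X in has_contour_integral _ _ _ _ X]mxE [X in _ * X]mxE.
  apply: (has_contour_integral_laurent ab pC1 gab C_avoids_0 C_winding s
    rho0 rhor gr HK (f := fun z => markov_function h u z i j)) => t tab.
  by rewrite mxE; exact: markov_cvg (gext t tab) i j.
have key n m : (two_pi_i R)^-1 *: mx_contour_integral gamma a b
    (fun z => mxpoly_eval (V m) z *m markov_function h u z *m mxpoly_eval (G n) z)
  = map_mx (real_complex R) (act_comp (G n) h u (B m)).
  under [X in mx_contour_integral _ _ _ X]eq_fun do rewrite mxpoly_eval_markov.
  have := has_mx_contour_integralE (
    has_mx_contour_integral_sum ab pC1 (index_enum _) (fun l : 'I_(size (V m)) =>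
    has_mx_contour_integral_sum ab pC1 (index_enum _) (fun k : 'I_(size (G n)) =>
    has_mx_contour_integralM ab pC1 (map_mx (real_complex R) (V m)`_l)
      (map_mx (real_complex R) (G n)`_k) (base (l + k)%N)))).
  move=> ->; rewrite B_def act_comp_mxpoly scaler_sumr map_mx_sum.
  apply: eq_bigr => l _.
  rewrite scaler_sumr map_mx_sum; apply: eq_bigr => k _.
  rewrite -scalemxAr -scalemxAl scalerA mulVf ?two_pi_i_neq0// scale1r.
  by rewrite !map_mxM.
have toC_inj : injective (map_mx (real_complex R) : 'M[R]_N'.+1 -> _).
  by apply: map_mx_inj.
have delta n m : (if n == m then 1%:M else 0) =
    map_mx (real_complex R) (if n == m then 1%:M else 0 : 'M[R]_N'.+1).
  by case: ifP => _; rewrite ?map_mx1 ?map_mx0.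
split=> H n m; first by rewrite key H delta.
by apply: toC_inj; rewrite -key H delta.
Qed.
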